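(* Let $p \in [1,\infty)$ and let $w := (w_n)_{n \in \mathbb{Z}}$ be a bounded sequence of nonzero scalars in $\mathbb{K}$. The bilateral weighted backward shift $$B_w : (x_n)_{n \in \mathbb{Z}} \in \ell^p(\mathbb{Z}) \mapsto (w_n x_{n+1})_{n \in \mathbb{Z}} \in \ell^p(\mathbb{Z})$$ is Li-Yorke chaotic if and only if the following conditions hold: (a) $\displaystyle \liminf_{n \to \infty} |w_{-n} \cdots w_{-1}| = 0$. (b) $\sup\{|w_i \cdots w_j| : i,j \in \mathbb{Z}, i \leq j\} = \infty$.
   Context: $\mathbb{K}$ denotes $\mathbb{R}$ or $\mathbb{C}$. $\ell^p(\mathbb{Z})$ is the usual Banach space of $p$-summable families $(x_n)_{n \in \mathbb{Z}}$ in $\mathbb{K}$. For $i \leq j$, $w_i\cdots w_j$ denotes the product of all $w_l$ with $i \leq l \leq j$. A continuous map $g : M \to M$ on a metric space $(M,d)$ is Li-Yorke chaotic if there is an uncountable set $S \subset M$ such that for all distinct $x,y \in S$, $\liminf_{n \to \infty} d(g^n(x),g^n(y)) = 0$ and $\limsup_{n\to\infty} d(g^n(x),g^n(y)) > 0$. *)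

(* Defs.v *)
From HB Require Import structures.
From mathcomp Require Import all_boot all_order all_algebra.
From mathcomp Require Import finmap complex.
From mathcomp Require Import all_classical all_reals all_analysis.

Set Implicit Arguments.
Unset Strict Implicit.
Unset Printing Implicit Defensive.

Import Order.TTheory GRing.Theory Num.Theory.
Import numFieldNormedType.Exports.

Local Open Scope fset_scope.
Local Open Scope classical_set_scope.
Local Open Scope ring_scope.

Variant scalar_kind := RealScalars | ComplexScalars.

Definition scalar_field (R : realType) (k : scalar_kind) : fieldType :=
  match k with RealScalars => R | ComplexScalars => R[i] end.

(* The usual absolute value, taken with values in [R]: the norm of [R[i]]
   provided by the library has values in [R[i]]. *)
Definition modulus (R : realType) (k : scalar_kind) : scalar_field R k -> R :=
  match k with
  | RealScalars => fun x : R => `|x|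
  | ComplexScalars => fun z : R[i] => ComplexField.Normc.normc z
  end.

Section modulus_theory.
Context {R : realType} {k : scalar_kind}.
Implicit Types x y : scalar_field R k.

Lemma modulus_ge0 x : 0 <= modulus x.
Proof.
by case: k x => [x|[a b]]; [exact: normr_ge0 | exact: sqrtr_ge0].
Qed.

Lemma modulus_eq0 x : modulus x = 0 -> x = 0.
Proof.
case: k x => [x|x]; first exact: normr0_eq0.
exact: ComplexField.Normc.eq0_normc.
Qed.

Lemma modulusM x y : modulus (x * y) = modulus x * modulus y.
Proof.
case: k x y => [x y|x y]; first exact: normrM.
exact: ComplexField.Normc.normcM.
Qed.

Lemma modulusD x y : modulus (x + y) <= modulus x + modulus y.
Proof.
case: k x y => [x y|x y]; first exact: ler_normD.
exact: le_normcD.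
Qed.

Lemma modulusN x : modulus (- x) = modulus x.
Proof.
case: k x => [x|x]; first exact: normrN.
exact: normcN.
Qed.

Lemma modulusMn x n : modulus (x *+ n) = modulus x *+ n.
Proof.
case: k x => [x|x]; first exact: normrMn.
exact: normcMn.
Qed.

Lemma modulus0 : modulus (0 : scalar_field R k) = 0.
Proof. by rewrite -(mulr0n 0) modulusMn. Qed.

End modulus_theory.

Definition bounded_weights (R : realType) (k : scalar_kind)
    (w : int -> scalar_field R k) : Prop :=
  exists M : R, forall n, modulus (w n) <= M.

HB.lock Definition lp_norm (R : realType) (k : scalar_kind) (p : R)
    (x : int -> scalar_field R k) : R :=
  fine (\esum_(n in [set: int]) (modulus (x n) `^ p)%:E) `^ p^-1.
Arguments lp_norm {R k} p x.

Section p_summable_families.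
Context {R : realType} {k : scalar_kind}.
Implicit Types (p : R) (x y : int -> scalar_field R k).

Definition p_summable p x : bool :=
  summable [set: int] (fun n => (modulus (x n) `^ p)%:E).

Definition weighted_shift_fun (w x : int -> scalar_field R k) :
    int -> scalar_field R k :=
  fun n => w n * x (n + 1).

Lemma p_summableE p x :
  p_summable p x = (\esum_(n in [set: int]) (modulus (x n) `^ p)%:E < +oo)%E.
Proof.
rewrite /p_summable /summable; congr (_ < _)%E.
by apply: eq_esum => n _; rewrite gee0_abs// lee_fin powR_ge0.
Qed.

Lemma lp_norm_ge0 p x : 0 <= lp_norm p x. Proof. by rewrite lp_norm.unlock powR_ge0. Qed.

Lemma sum_le_lp_norm p x (F : {fset int}) : 1 <= p -> p_summable p x ->
  \sum_(n <- F) modulus (x n) `^ p <= lp_norm p x `^ p.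
Proof.
move=> p1; have p0 : 0 < p by rewrite (lt_le_trans _ p1).
rewrite p_summableE => xfin.
have N0 : (0 <= \esum_(n in [set: int]) (modulus (x n) `^ p)%:E)%E.
  by apply: esum_ge0 => n _; rewrite lee_fin powR_ge0.
rewrite lp_norm.unlock -powRrM mulVf ?gt_eqF// powRr1 ?fine_ge0//.
rewrite -lee_fin fineK ?ge0_fin_numE// -sumEFin.
apply: ereal_sup_ubound; exists [set` F]; first by split.
by rewrite fsbig_finite//= set_fsetK.
Qed.

Lemma lp_norm_le p x c : 1 <= p -> 0 <= c ->
  (forall F : {fset int}, \sum_(n <- F) modulus (x n) `^ p <= c `^ p) ->
  p_summable p x /\ lp_norm p x <= c.
Proof.
move=> p1 c0 xc; have p0 : 0 < p by rewrite (lt_le_trans _ p1).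
have N0 : (0 <= \esum_(n in [set: int]) (modulus (x n) `^ p)%:E)%E.
  by apply: esum_ge0 => n _; rewrite lee_fin powR_ge0.
have Nc : (\esum_(n in [set: int]) (modulus (x n) `^ p)%:E <= (c `^ p)%:E)%E.
  apply: ge_ereal_sup => _ [A [finA _] <-].
  by rewrite fsbig_finite//= sumEFin lee_fin.
have Nfin : (\esum_(n in [set: int]) (modulus (x n) `^ p)%:E < +oo)%E.
  exact: le_lt_trans Nc (ltry _).
rewrite p_summableE; split => //.
have -> : c = (c `^ p) `^ p^-1 by rewrite -powRrM mulfV ?gt_eqF// powRr1.
rewrite lp_norm.unlock ge0_ler_powR ?invr_ge0 ?nnegrE ?fine_ge0 ?powR_ge0 ?(ltW p0)//.
by rewrite -lee_fin fineK// ge0_fin_numE.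
Qed.

Lemma convex_modulus p (a b : R) (u v : scalar_field R k) :
  1 <= p -> 0 < a -> 0 < b ->
  modulus (u + v) `^ p <= (a + b) `^ p *
    (a / (a + b) * (modulus u `^ p / a `^ p) +
     b / (a + b) * (modulus v `^ p / b `^ p)).
Proof.
move=> p1 a0 b0; have p0 : 0 < p by rewrite (lt_le_trans _ p1).
have ab0 : 0 < a + b by rewrite addr_gt0.
have t01 : 0 <= a / (a + b) <= 1.
  by rewrite divr_ge0 ?(ltW a0) ?(ltW ab0)//= ler_pdivrMr// mul1r lerDl ltW.
pose t := Itv01 (andP t01).1 (andP t01).2.
have bt : b / (a + b) = 1 - a / (a + b).
  by rewrite -[1](@divff _ (a + b)) ?gt_eqF// -mulrBl addrAC subrr add0r.
have inv z c : 0 < c -> 0 <= z -> z `^ p / c `^ p = (z / c) `^ p.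
  move=> c0 z0; rewrite powRM ?invr_ge0 ?(ltW c0)//; congr (_ * _).
  by rewrite -(powR_inv1 (ltW c0)) -powRrM mulrC powRrM powR_inv1 ?powR_ge0.
rewrite !inv ?modulus_ge0//.
have in0 c (z : scalar_field R k) : 0 < c ->
    modulus z / c \in (`[0, +oo[%classic : set R).
  by move=> c0; rewrite inE/= in_itv/= andbT divr_ge0 ?modulus_ge0 ?(ltW c0).
have := convex_powR p1 t (in0 _ u a0) (in0 _ v b0).
rewrite convRE [X in X `^ _ <= _ -> _]convRE /= /unstable.onem -bt => cvx.
apply: (le_trans _ (ler_wpM2l (powR_ge0 _ _) cvx)).
have abc0 c (z : scalar_field R k) : 0 < c -> 0 <= c / (a + b) * (modulus z / c).
  by move=> c0; rewrite mulr_ge0 ?divr_ge0 ?modulus_ge0 ?(ltW c0) ?(ltW ab0).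
have S0 := addr_ge0 (abc0 _ u a0) (abc0 _ v b0).
rewrite -powRM ?S0 ?(ltW ab0)//.
rewrite ge0_ler_powR ?nnegrE ?modulus_ge0 ?(ltW p0)//.
  by rewrite mulr_ge0 ?S0 ?(ltW ab0).
rewrite (le_trans (modulusD _ _))// mulrDr.
have sim c (z : scalar_field R k) : 0 < c ->
    (a + b) * (c / (a + b) * (modulus z / c)) = modulus z.
  move=> c0; rewrite mulrA [X in X * _]mulrCA divff ?gt_eqF// mulr1.
  by rewrite mulrCA divff ?gt_eqF// mulr1.
by rewrite !sim.
Qed.

Lemma lp_normD p x y : 1 <= p -> p_summable p x -> p_summable p y ->
  p_summable p (x + y) /\ lp_norm p (x + y) <= lp_norm p x + lp_norm p y.
Proof.
move=> p1 sx sy; have p0 : 0 < p by rewrite (lt_le_trans _ p1).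
have key a b : lp_norm p x < a -> lp_norm p y < b ->
    p_summable p (x + y) /\ lp_norm p (x + y) <= a + b.
  move=> xa yb.
  have a0 : 0 < a by rewrite (le_lt_trans (lp_norm_ge0 _ _) xa).
  have b0 : 0 < b by rewrite (le_lt_trans (lp_norm_ge0 _ _) yb).
  have ab0 : 0 < a + b by rewrite addr_gt0.
  apply: lp_norm_le => // [|F]; first exact: ltW.
  have bnd z c : 0 < c -> p_summable p z -> lp_norm p z <= c ->
      \sum_(n <- F) modulus (z n) `^ p / c `^ p <= 1.
    move=> c0 sz zc; rewrite -mulr_suml ler_pdivrMr ?powR_gt0// mul1r.
    apply: (le_trans (sum_le_lp_norm F p1 sz)).
    by rewrite ge0_ler_powR ?nnegrE ?lp_norm_ge0 ?(ltW p0) ?(ltW c0).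
  apply: (le_trans (ler_sum _ (fun n _ => convex_modulus (x n) (y n) p1 a0 b0))).
  rewrite -mulr_sumr big_split/= -!mulr_sumr.
  rewrite -[leRHS]mulr1 ler_wpM2l ?powR_ge0//.
  have <- : a / (a + b) + b / (a + b) = 1 by rewrite -mulrDl divff ?gt_eqF.
  by apply: lerD; rewrite -[leRHS]mulr1 ler_wpM2l ?bnd ?(ltW xa) ?(ltW yb)//
    divr_ge0 ?(ltW a0) ?(ltW b0) ?(ltW ab0).
split; first by have [] := key (lp_norm p x + 1) (lp_norm p y + 1);
  rewrite ?ltrDl.
apply/ler_addgt0Pl => e e0; have e20 : 0 < e / 2 by rewrite divr_gt0.
have [||_ /le_trans] := key (lp_norm p x + e / 2) (lp_norm p y + e / 2).
- by rewrite ltrDl.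
- by rewrite ltrDl.
by apply; rewrite addrACA -splitr addrC.
Qed.

Lemma lp_norm_dominated p x y (c : R) : 1 <= p -> 0 <= c -> p_summable p x ->
  (exists2 s : int -> int, injective s &
    forall n, modulus (y n) <= c * modulus (x (s n))) ->
  p_summable p y /\ lp_norm p y <= c * lp_norm p x.
Proof.
move=> p1 c0 sx [s s_inj yx]; have p0 : 0 < p by rewrite (lt_le_trans _ p1).
apply: lp_norm_le => // [|F]; first by rewrite mulr_ge0 ?lp_norm_ge0.
rewrite powRM ?lp_norm_ge0//.
apply: (@le_trans _ _ (\sum_(n <- F) c `^ p * modulus (x (s n)) `^ p)).
  apply: ler_sum => n _; rewrite -powRM ?modulus_ge0//.
  by rewrite ge0_ler_powR ?nnegrE ?mulr_ge0 ?modulus_ge0 ?(ltW p0).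
rewrite -mulr_sumr ler_wpM2l ?powR_ge0//.
apply: (le_trans _ (sum_le_lp_norm [fset s n | n in F]%fset p1 sx)).
by rewrite big_imfset//= => ? ? _ _; exact: s_inj.
Qed.

Lemma p_summable0 p : 1 <= p ->
  p_summable p (0 : int -> scalar_field R k) /\
  lp_norm p (0 : int -> scalar_field R k) <= 0.
Proof.
move=> p1; have p0 : 0 < p by rewrite (lt_le_trans _ p1).
apply: lp_norm_le => // F; rewrite big1 ?powR_ge0// => n _.
by rewrite modulus0 powR0 ?gt_eqF.
Qed.

Lemma p_summableZ p (c : scalar_field R k) x : 1 <= p -> p_summable p x ->
  p_summable p (fun n => c * x n).
Proof.
move=> p1 sx.
have [] // := @lp_norm_dominated p x (fun n => c * x n) (modulus c) p1.
  exact: modulus_ge0.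
by exists id => // n; rewrite modulusM.
Qed.

Lemma p_summableN p x : 1 <= p -> p_summable p x -> p_summable p (- x).
Proof.
move=> p1 sx; have [] // := @lp_norm_dominated p x (- x) 1 p1.
by exists id => // n; rewrite mul1r modulusN.
Qed.

Lemma lp_normMn p x n : 1 <= p -> p_summable p x ->
  lp_norm p (x *+ n) = lp_norm p x *+ n.
Proof.
move=> p1 sx; case: n => [|n].
  by apply/le_anti; rewrite lp_norm_ge0 mulr0n (p_summable0 p1).2.
have fctMn m : (x *+ n.+1) m = x m *+ n.+1.
  by elim: n.+1 => [|i IHi]; rewrite ?mulr0n// !mulrS -IHi.
have [sxn le1] : p_summable p (x *+ n.+1) /\
    lp_norm p (x *+ n.+1) <= n.+1%:R * lp_norm p x.
  apply: lp_norm_dominated => //; exists id => // m.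
  by rewrite fctMn modulusMn mulr_natl.
have [_ le2] : p_summable p x /\
    lp_norm p x <= n.+1%:R^-1 * lp_norm p (x *+ n.+1).
  apply: lp_norm_dominated; rewrite ?invr_ge0//; exists id => // m.
  by rewrite fctMn modulusMn -[modulus _ *+ _]mulr_natl mulKf ?pnatr_eq0.
rewrite -[RHS]mulr_natl; apply/le_anti; rewrite le1/=.
by rewrite -ler_pdivlMl.
Qed.

Lemma lp_norm_eq0 p x : 1 <= p -> p_summable p x -> lp_norm p x = 0 -> x = 0.
Proof.
move=> p1 sx x0; have p0 : 0 < p by rewrite (lt_le_trans _ p1).
apply/funext => n; apply: modulus_eq0; apply: (@powR_eq0_eq0 _ _ p).
apply/le_anti; rewrite powR_ge0 andbT.
have := sum_le_lp_norm [fset n]%fset p1 sx.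
by rewrite big_seq_fset1 x0 powR0 ?gt_eqF.
Qed.

Lemma p_summable_weighted_shift p (w x : int -> scalar_field R k) :
  1 <= p -> bounded_weights w -> p_summable p x ->
  p_summable p (weighted_shift_fun w x).
Proof.
move=> p1 [M wM] sx; have M0 := le_trans (modulus_ge0 _) (wM 0).
have [] // := @lp_norm_dominated p x (weighted_shift_fun w x) M p1 M0 sx.
exists (fun n => n + 1) => [|n]; first exact: addIr.
by rewrite modulusM ler_wpM2r ?modulus_ge0.
Qed.

End p_summable_families.

(* The proof [p1] is a parameter of the type so that the normed structure on
   it can be inferred. *)
Record lp_space (R : realType) (k : scalar_kind) (p : R) (p1 : 1 <= p) := LpSpace {
  lp_fun :> int -> scalar_field R k ;
  lp_summable : p_summable p lp_fun }.

Section lp_space_structure.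
Context {R : realType} {k : scalar_kind} {p : R} {p1 : 1 <= p}.
Local Notation lp := (lp_space k p1).
Implicit Types (a b : scalar_field R k) (x y z : lp).

HB.instance Definition _ := [isSub for @lp_fun R k p p1].
HB.instance Definition _ := [Choice of lp by <:].

Definition lp_zero : lp := LpSpace p1 (p_summable0 p1).1.
Definition lp_opp x : lp := LpSpace p1 (p_summableN p1 (lp_summable x)).
Definition lp_add x y : lp :=
  LpSpace p1 (lp_normD p1 (lp_summable x) (lp_summable y)).1.
Definition lp_scale a x : lp := LpSpace p1 (p_summableZ a p1 (lp_summable x)).

Let lp_addA : associative lp_add.
Proof. by move=> x y z; apply: val_inj; apply: addrA. Qed.
Let lp_addC : commutative lp_add.
Proof. by move=> x y; apply: val_inj; apply: addrC. Qed.
Let lp_add0 : left_id lp_zero lp_add.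
Proof. by move=> x; apply: val_inj; apply: add0r. Qed.
Let lp_addN : left_inverse lp_zero lp_opp lp_add.
Proof. by move=> x; apply: val_inj; apply: addNr. Qed.

HB.instance Definition _ :=
  GRing.isZmodule.Build lp lp_addA lp_addC lp_add0 lp_addN.

Let lp_scaleA a b x : lp_scale a (lp_scale b x) = lp_scale (a * b) x.
Proof. by apply/val_inj/funext => n /=; rewrite mulrA. Qed.
Let lp_scale1 : left_id 1 lp_scale.
Proof. by move=> x; apply/val_inj/funext => n /=; rewrite mul1r. Qed.
Let lp_scaleDr : right_distributive lp_scale +%R.
Proof. by move=> a x y; apply/val_inj/funext => n /=; apply: mulrDr. Qed.
Let lp_scaleDl x : {morph lp_scale^~ x : a b / a + b}.
Proof. by move=> a b; apply/val_inj/funext => n /=; apply: mulrDl. Qed.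

HB.instance Definition _ := GRing.Zmodule_isLmodule.Build (scalar_field R k) lp
  lp_scaleA lp_scale1 lp_scaleDr lp_scaleDl.

Lemma lp_funD x y : lp_fun (x + y) = lp_fun x + lp_fun y.
Proof. by []. Qed.
Lemma lp_funN x : lp_fun (- x) = - lp_fun x.
Proof. by []. Qed.
Lemma lp_funMn x n : lp_fun (x *+ n) = lp_fun x *+ n.
Proof. by elim: n => [|n IHn]; rewrite ?mulr0n// !mulrS lp_funD IHn. Qed.

Let norm x : R := lp_norm p x.

Let normD x y : norm (x + y) <= norm x + norm y.
Proof. exact: (lp_normD p1 (lp_summable x) (lp_summable y)).2. Qed.
Let norm_eq0 x : norm x = 0 -> x = 0.
Proof. by move=> /(lp_norm_eq0 p1 (lp_summable x)) x0; apply: val_inj. Qed.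
Let normMn x n : norm (x *+ n) = norm x *+ n.
Proof. by rewrite /norm lp_funMn lp_normMn// lp_summable. Qed.
Let normN x : norm (- x) = norm x.
Proof.
rewrite /norm lp_norm.unlock; congr (fine _ `^ _).
by apply: eq_esum => n _; rewrite lp_funN modulusN.
Qed.

HB.instance Definition _ :=
  Num.Zmodule_isNormed.Build R lp normD norm_eq0 normMn normN.

Let dist x y : R := `|y - x|.

Let distxx x : dist x x = 0. Proof. by rewrite /dist subrr normr0. Qed.
Let dist_positivity x y : dist x y = 0 -> x = y.
Proof. by move/normr0_eq0/eqP; rewrite subr_eq0 => /eqP. Qed.
Let dist_sym x y : dist x y = dist y x. Proof. exact: distrC. Qed.
Let dist_triangle y x z : dist x z <= dist x y + dist y z.
Proof. by rewrite /dist (addrC `|y - x|) ler_distD. Qed.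

HB.instance Definition _ := isPointed.Build lp 0.
HB.instance Definition _ :=
  isMetric.Build R lp distxx dist_positivity dist_sym dist_triangle.
HB.instance Definition _ :=
  NormedZmoduleMetric.Build R lp (fun x y => erefl).

End lp_space_structure.

Definition weighted_shift (R : realType) (k : scalar_kind) (p : R) (p1 : 1 <= p)
    (w : int -> scalar_field R k) (wb : bounded_weights w) (x : lp_space k p1) :
    lp_space k p1 :=
  LpSpace p1 (p_summable_weighted_shift p1 wb (lp_summable x)).

Definition li_yorke_chaotic (R : realType) (M : metricType R) (g : M -> M) : Prop :=
  continuous g /\
  exists S : set M, ~ countable S /\
    forall x y, S x -> S y -> x <> y ->
      limn_einf (fun n => (mdist (iter n g x) (iter n g y))%:E) = 0%E /\
      (0 < limn_esup (fun n => (mdist (iter n g x) (iter n g y))%:E))%E.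

(* For [j < i] the product is empty, hence equal to [1]. *)
Definition weight_prod (R : realType) (k : scalar_kind) (w : int -> scalar_field R k)
    (i j : int) : scalar_field R k :=
  \big[*%R/1]_(l \in [set l : int | i <= l <= j]) w l.

(* Main.v *)
(* Write [T] for the shift, [e t] for the basis vectors and [N n t] for
   [||T^n (e t)|| = |w_(t-n) ... w_(t-1)|]. By linearity and by taking the real
   multiples of one vector, [T] is Li-Yorke chaotic iff some [x] satisfies
   [liminf ||T^n x|| = 0 < limsup ||T^n x||].
   If such an [x] exists, any nonzero coordinate of it gives (a), and (b) holds
   because the orbits of a power bounded operator with zero liminf tend to 0.
   Conversely assume (a) and (b). If [limsup N n 0 > 0] then [x = e 0] works.
   Otherwise [N n t] tends to 0 in [n] for every [t] while being unbounded in
   [(n, t)]; since [||T^n x||^p] is the sum over [t] of [N n t ^ p * |x t| ^ p],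
   a gliding hump produces [x] with an unbounded orbit and zero liminf. *)
Require Import Defs.
From mathcomp Require Import all_boot all_order all_algebra.
From mathcomp Require Import lra finmap complex.
From mathcomp Require Import all_classical all_reals all_analysis.

Import Order.TTheory GRing.Theory Num.Theory.

Local Open Scope classical_set_scope.
Local Open Scope ring_scope.

(** * Lower and upper limits in epsilon form *)

(** The lower limit is the supremum of the tail infima; these are nonnegative, so it vanishes iff
    each of them does. *)
Lemma limn_einf_eq0P {R : realType} (u : nat -> R) : (forall n, 0 <= u n) ->
  limn_einf (fun n => (u n)%:E) = 0%E <->
  forall e, 0 < e -> forall n, exists2 m, (n <= m)%N & u m < e.
Proof.
move=> u0; have inf_ge0 n : (0 <= einfs (fun n => (u n)%:E) n)%E.
  by apply: le_ereal_inf_tmp => _ [m _ <-]; rewrite lee_fin.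
have -> : limn_einf (fun n => (u n)%:E) =
    ereal_sup (range (einfs (fun n => (u n)%:E))).
  by rewrite limn_einf_lim; apply/cvg_lim => //; exact: cvg_einfs_sup.
split=> [sup0 e e0 n|small].
  have : (einfs (fun n => (u n)%:E) n < e%:E)%E.
    by apply: (@le_lt_trans _ _ 0%E); rewrite ?lte_fin// -sup0;
      apply: ereal_sup_ubound; exists n.
  by move=> /ereal_inf_lt[_ [m /= nm <-]]; rewrite lte_fin; exists m.
apply/le_anti/andP; split; last first.
  by apply: (le_trans (inf_ge0 0)); apply: ereal_sup_ubound; exists 0%N.
apply: ge_ereal_sup => _ [n _ <-]; apply/lee_addgt0Pr => e e0.
have [m nm /ltW ume] := small e e0 n; rewrite add0e.
apply: (@le_trans _ _ (u m)%:E); last by rewrite lee_fin.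
by apply: ereal_inf_lbound; exists m.
Qed.

Lemma limn_esup_gt0P {R : realType} (u : nat -> R) :
  (0 < limn_esup (fun n => (u n)%:E))%E <->
  exists2 e, 0 < e & forall n, exists2 m, (n <= m)%N & e <= u m.
Proof.
have -> : limn_esup (fun n => (u n)%:E) =
    ereal_inf (range (esups (fun n => (u n)%:E))).
  by rewrite limn_esup_lim; apply/cvg_lim => //; exact: cvg_esups_inf.
split=> [|[e e0 large]]; last first.
  apply: (@lt_le_trans _ _ e%:E) => //.
  apply: le_ereal_inf_tmp => _ [n _ <-]; have [m nm em] := large n.
  apply: (@le_trans _ _ (u m)%:E) => //.
  by apply: ereal_sup_ubound; exists m.
set l := ereal_inf _ => l0.
have [e e0 el] : exists2 e : R, 0 < e & (e%:E < l)%E.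
  (* The infimum [l] may be [+oo], and then any positive real serves. *)
  case: l l0 => [r||//]; last by exists 1; rewrite ?ltry.
  rewrite lte_fin => r0; exists (r / 2); first by rewrite divr_gt0.
  by rewrite lte_fin ltr_pdivrMr// mulr_natr mulr2n ltrDl.
exists e => // n; have : (e%:E < esups (fun n => (u n)%:E) n)%E.
  by apply: (lt_le_trans el); apply: ereal_inf_lbound; exists n.
by move=> /ereal_sup_gt[_ [m /= nm <-]]; rewrite lte_fin => /ltW; exists m.
Qed.

Lemma not_limsup_gt0 {R : realType} (u : nat -> R) :
  ~ (exists2 e, 0 < e & forall n, exists2 m, (n <= m)%N & e <= u m) ->
  forall e, 0 < e -> exists n, forall m, (n <= m)%N -> u m < e.
Proof.
move=> nu e e0; apply: contrapT => ne; apply: nu; exists e => // n.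
apply: contrapT => nm; apply: ne; exists n => m nm'.
by rewrite ltNge; apply/negP => em; apply: nm; exists m.
Qed.

(** * Gliding hump *)

(* [u] is the push-forward along [m] of the measure with masses [b]. *)
Lemma exists_pushforward_weight {R : realType} {T : eqType}
    (b : nat -> R) (m : nat -> T) (C : R) : (forall j, 0 <= b j) ->
  (forall J, \sum_(0 <= j < J) b j <= C) ->
  exists u : T -> R, [/\ forall t, 0 <= u t, forall j, b j <= u (m j) &
    forall (Q : T -> R) K, (forall t, 0 <= Q t) ->
      (forall J, \sum_(0 <= j < J) b j * Q (m j) <= K) ->
      forall F : seq T, uniq F -> \sum_(t <- F) Q t * u t <= K].
Proof.
(* The map [m] need not be injective, so the mass at [t] collects every [b j] with [m j = t], as a
   limit of partial sums. *)
move=> b0 bC; pose U t J := \sum_(0 <= j < J) b j *+ (m j == t).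
have U_nd t : {homo U t : n k / (n <= k)%N >-> n <= k}.
  move=> n k nk; rewrite /U [leRHS](big_cat_nat (leq0n n) nk)/= lerDl.
  by apply: sumr_ge0 => j _; exact: mulrn_wge0.
have U_cvg t : cvgn (U t).
  apply: nondecreasing_is_cvgn => //; exists C => _ [J _ <-].
  apply: le_trans (bC J); apply: ler_sum => j _.
  by case: (m j == t); rewrite ?mulr1n ?mulr0n.
have U_le t J : U t J <= limn (U t) by exact: nondecreasing_cvgn_le.
exists (fun t => limn (U t)); split=> [t|j|Q K Q0 QK F uF].
- by apply: le_trans (U_le t 0%N); rewrite /U big_geq.
- apply: le_trans (U_le _ j.+1); rewrite /U big_nat_recr//= eqxx mulr1n lerDr.
  by apply: sumr_ge0 => i _; exact: mulrn_wge0.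
have FJ : (fun J => \sum_(t <- F) Q t * U t J) @ \oo -->
    \sum_(t <- F) Q t * limn (U t).
  apply: cvg_big => [|t _]; first exact: add_continuous.
  by apply: cvgMl_tmp; exact: U_cvg.
rewrite -(cvg_lim _ FJ)//; apply: limr_le; first exact: cvgP FJ.
apply: nearW => J; apply: le_trans (QK J).
under eq_bigr do rewrite mulr_sumr.
(* After the exchange, index [j] contributes [b j * Q (m j)] once if [m j] lies in [F], as [F] has
   no repetition, and 0 otherwise. *)
rewrite exchange_big/=; apply: ler_sum => j _.
have [jF|jF] := boolP (m j \in F).
  rewrite (bigD1_seq (m j))//= eqxx mulr1n big1 ?addr0 1?mulrC// => t /negPf.
  by rewrite eq_sym => ->; rewrite mulr0n mulr0.
rewrite big_seq big1 ?mulr_ge0// => t tF.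
by case: eqP tF jF => [->|_ _ _]; [move=> ->|rewrite mulr0n mulr0].
Qed.

(** The sum telescopes, each term being [2 ^- j - 2 ^- j.+1]. *)
Lemma sum_half_pow {R : realType} i J :
  \sum_(i <= j < i + J) (2 ^- j.+1 : R) <= 2 ^- i.
Proof.
suff -> : \sum_(i <= j < i + J) (2 ^- j.+1 : R) = 2 ^- i - 2 ^- (i + J).
  by rewrite gerBl invr_ge0 exprn_ge0.
elim: J => [|J IH]; first by rewrite addn0 big_geq// subrr.
rewrite addnS big_nat_recr ?leq_addr//= IH exprS invfM.
move: (2 ^+ (i + J))^-1 (2 ^+ i)^-1 => y z; lra.
Qed.

Lemma exists_half_pow_le {R : realType} (e : R) n : 0 < e ->
  exists2 i, (n <= i)%N & 2 ^- i + 2 ^- i <= e.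
Proof.
(* From [2 / e <= i < 2 ^ i] it follows that twice [2 ^- i] is at most [e]. *)
move=> e0; exists (maxn n (Num.bound (2 / e))); first exact: leq_maxl.
set i := maxn _ _; rewrite -mulr2n -[leLHS]mulr_natl ler_pdivrMr ?exprn_gt0//.
rewrite -ler_pdivrMl// mulrC.
have : 2 / e < (Num.bound (2 / e))%:R.
  by apply: le_lt_trans (archi_boundP _); rewrite ?ler_norm// divr_ge0// ltW.
move=> /ltW/le_trans; apply; apply: (@le_trans _ _ i%:R).
  by rewrite ler_nat leq_maxr.
by rewrite -natrX ler_nat ltnW// ltn_expl.
Qed.

(* The masses of [u] sit at points [m 0, m 1, ...]; the mass at [m j] is so
   small that [P (N i)] cannot see it for [i <= j], where [N i] is a time at
   which [P] is already small at [m 0, ..., m (i - 1)], and [m j] is a point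
   where [P] is large enough to compensate the smallness of that mass. *)
Lemma gliding_hump {R : realType} {T : eqType} (P : nat -> T -> R) (B : nat -> R) :
  (forall n t, 0 <= P n t <= B n) -> (forall n, 1 <= B n) ->
  {homo B : m n / (m <= n)%N >-> m <= n} ->
  (forall t e, 0 < e -> exists n, forall m, (n <= m)%N -> P m t < e) ->
  (forall C, exists t n, C <= P n t) ->
  exists u : T -> R, [/\ forall t, 0 <= u t,
    forall F : seq T, uniq F -> \sum_(t <- F) u t <= 1,
    forall e, 0 < e -> forall n, exists2 k, (n <= k)%N &
      forall F : seq T, uniq F -> \sum_(t <- F) P k t * u t <= e &
    forall C, exists t n, C <= P n t * u t].
Proof.
move=> PB B1 B_nd P_cvg0 P_unbounded.
have P0 n t : 0 <= P n t by case/andP: (PB n t).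
have sum_cvg0 s : forall e, 0 < e ->
    exists n, forall m, (n <= m)%N -> \sum_(t <- s) P m t <= e.
  elim: s => [e e0|t s IHs e e0].
    by exists 0%N => m _; rewrite big_nil ltW.
  have e20 : 0 < e / 2 by rewrite divr_gt0.
  have [[n1 Pn1] [n2 Pn2]] := (P_cvg0 t _ e20, IHs _ e20).
  exists (maxn n1 n2) => m; rewrite geq_max => /andP[n1m n2m].
  by rewrite big_cons (splitr e) lerD ?Pn2// ltW// Pn1.
have /choice[f fP] (x : seq T * nat) : exists k,
    (x.2 <= k)%N /\ \sum_(t <- x.1) P k t <= 2 ^- x.2.
  have [|n Pn] := sum_cvg0 x.1 (2 ^- x.2); first by rewrite invr_gt0 exprn_gt0.
  by exists (maxn x.2 n); rewrite leq_maxl Pn// leq_maxr.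
have /choice[g gP] := P_unbounded.
(* Calibrated against the mass [b j] below: [C j (N j) * b j] equals [j.+1], which is unbounded. *)
pose C j n := j.+1%:R * (2 ^+ j.+1 * B n).
(* A state holds the points chosen so far and a time. A step adds a point at which [P] is huge
   relative to that time, then picks a time, no earlier, at which [P] is small on all points so
   far. *)
pose step j (x : seq T * nat) :=
  let s := rcons x.1 (g (C j x.2)) in (s, f (s, maxn x.2 j.+1)).
pose st j := iteri j step ([::], f ([::], 0%N)).
pose N j := (st j).2; pose m j := g (C j (N j)).
have st_sum j (F : T -> R) : \sum_(t <- (st j).1) F t = \sum_(0 <= i < j) F (m i).
  elim: j => [|j IHj]; first by rewrite big_nil big_geq.
  by rewrite big_nat_recr//= big_rcons/= IHj addrC.
have N_nd : {homo N : i j / (i <= j)%N}.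
  apply: homo_leq => [//|i j k|j]; first exact: leq_trans.
  by rewrite /N/=; case: (fP (rcons (st j).1 (m j), maxn (N j) j.+1)) => /=;
    rewrite geq_max => /andP[].
have N_P j : (j <= N j)%N /\ \sum_(0 <= i < j) P (N j) (m i) <= 2 ^- j.
  rewrite -(st_sum j (P (N j))).
  case: j => [|j]; first by rewrite big_nil invr_ge0 exprn_ge0.
  have [] := fP ((st j.+1).1, maxn (N j) j.+1); rewrite -/(N j.+1)/= geq_max.
  move=> /andP[_ jN] sP; split=> //; apply: le_trans sP _.
  by rewrite lef_pV2 ?posrE ?exprn_gt0// ler_eXn2l ?ltr1n// leq_maxr.
have B0 n : 0 < B n by exact: lt_le_trans (B1 n).
(* Dividing by [B (N j)] makes [b j * P (N i) (m j)] at most [2 ^- j.+1] whenever [i <= j], since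
   [B] and [N] are nondecreasing. *)
pose b j := 2 ^- j.+1 / B (N j).
have b0 j : 0 <= b j by rewrite divr_ge0 ?invr_ge0 ?exprn_ge0// ltW.
have b_le j : b j <= 2 ^- j.+1.
  by rewrite ler_pdivrMr// ler_peMr// invr_ge0 exprn_ge0.
have b_sum J : \sum_(0 <= j < J) b j <= 1.
  apply: le_trans (ler_sum _ (fun j _ => b_le j)) _.
  by have := @sum_half_pow R 0 J; rewrite expr0 invr1 add0n.
have [u [u0 bu uP]] := exists_pushforward_weight b m 1 b0 b_sum.
exists u; split=> //.
- move=> F uF; have := uP (fun=> 1) 1 (fun=> ler01) _ F uF.
  under eq_bigr do rewrite mul1r; apply.
  by move=> J; under eq_bigr do rewrite mulr1; exact: b_sum.
- move=> e e0 n; have [i ni ie] := exists_half_pow_le _ n e0.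
  exists (N i) => [|F uF]; first exact: leq_trans (N_P i).1.
  apply: uP => // J; apply: le_trans ie.
  (* The sum is lengthened so that it can be cut at [i]: the choice of [N i] controls the points
     before [i], the small masses control the others, and each part is at most [2 ^- i]. *)
  apply: (@le_trans _ _ (\sum_(0 <= j < i + J) b j * P (N i) (m j))).
    rewrite [leRHS](big_cat_nat (leq0n J) (leq_addl i J))/= lerDl.
    by apply: sumr_ge0 => j _; rewrite mulr_ge0.
  rewrite (big_cat_nat (leq0n i) (leq_addr J i))/=; apply: lerD.
    apply: le_trans (N_P i).2; apply: ler_sum => j _; rewrite ler_piMl//.
    apply: le_trans (b_le j) _.
    by rewrite invf_le1 ?exprn_gt0// exprn_ege1// ler1n.
  apply: le_trans (sum_half_pow i J); apply: ler_sum_nat => j /andP[ij _].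
  rewrite -[leRHS]mulr1 -mulrA ler_wpM2l ?invr_ge0 ?exprn_ge0//.
  rewrite mulrC ler_pdivrMr// mul1r.
  by case/andP: (PB (N i) (m j)) => _ /le_trans; apply; apply/B_nd/N_nd.
move=> A; pose j := Num.bound `|A|; have [n Pn] := gP (C j (N j)).
exists (m j), n; apply: (@le_trans _ _ j.+1%:R).
  apply/(le_trans (ler_norm _))/ltW.
  by rewrite (lt_trans (archi_boundP (normr_ge0 A)))// ltr_nat.
apply: (@le_trans _ _ (C j (N j) * b j)).
  rewrite /C /b -[leRHS]mulrA [X in _ * X](_ : _ = 1) ?mulr1//.
  by rewrite -invfM mulfV// mulf_neq0// gt_eqF ?exprn_gt0.
by rewrite ler_pM// mulr_ge0// mulr_ge0 ?exprn_ge0// ltW.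
Qed.

(** * Real scalars and uncountability of the reals *)

Lemma modulus1 {R : realType} {k : scalar_kind} : modulus (1 : scalar_field R k) = 1.
Proof. by case: k; [exact: normr1|exact: ComplexField.Normc.normc1]. Qed.

Definition scalar_of_real {R : realType} (k : scalar_kind) : R -> scalar_field R k :=
  match k with RealScalars => fun r => r | ComplexScalars => fun r => (r%:C)%C end.

Lemma modulus_of_real {R : realType} (k : scalar_kind) (r : R) :
  modulus (scalar_of_real k r) = `|r|.
Proof. by case: k => //=; rewrite expr0n addr0 sqrtr_sqr. Qed.

Lemma scalar_of_realB {R : realType} (k : scalar_kind) (r s : R) :
  scalar_of_real k (r - s) = scalar_of_real k r - scalar_of_real k s.
Proof. by case: k => //; exact: (rmorphB (real_complex R)). Qed.

(** A countable set is Lebesgue null, whereas the unit interval has measure 1. *)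
Lemma uncountable_realType (R : realType) : ~ countable [set: R].
Proof.
move=> cR; have c01 : countable `[0 : R, 1].
  by apply: sub_countable cR; exact: subset_card_le.
have := countable_lebesgue_measure0 c01.
by rewrite lebesgue_measure_itv/= lte_fin ltr01 sube0 => /eqP; rewrite eqe oner_eq0.
Qed.

(** * Products of consecutive weights *)

Section window.
Context {R : realType} {k : scalar_kind} (w : int -> scalar_field R k).

(** Indexing by length and left end makes lengths add under concatenation, as exponents do for
    powers of the shift. *)
Definition window (n : nat) (i : int) : scalar_field R k :=
  \prod_(l < n) w (i + l%:Z).

Lemma weight_prod_window i n : weight_prod w i (i + n%:Z - 1) = window n i.
Proof.
rewrite /window (@fsbig_ord _ _ _ _ (fun l => w (i + l%:Z))) /weight_prod.
apply: reindex_fsbig; split=> [l /= ln|l m _ _ /addrI[]//|l /= /andP[il lj]].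
  by rewrite lerDl lez_nat leq0n -addrA lerD2l -ltzD1 subrK ltz_nat.
have [m lm] : exists m : nat, l - i = m%:Z.
  by exists `|l - i|%N; rewrite gez0_abs// subr_ge0.
exists m => /=; last by rewrite -lm addrC subrK.
by move: lj; rewrite -ltzD1 subrK -ltz_nat -lm ltrBlDl.
Qed.

Lemma windowD a b i : window (a + b) i = window a i * window b (i + a%:Z).
Proof.
rewrite /window big_split_ord/=; congr (_ * _); apply: eq_bigr => l _.
by rewrite PoszD addrA.
Qed.

Lemma window1 i : window 1 i = w i.
Proof. by rewrite /window big_ord1 addr0. Qed.

Lemma modulus_window_le D n i : (forall l, modulus (w l) <= D) ->
  modulus (window n i) <= D ^+ n.
Proof.
move=> wD; have D0 : 0 <= D by exact: le_trans (modulus_ge0 _) (wD 0).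
elim: n i => [|n IHn] i; first by rewrite /window big_ord0 modulus1 expr0.
by rewrite -addn1 windowD modulusM window1 exprD expr1 ler_pM// modulus_ge0.
Qed.

Lemma window_neq0 n i : (forall l, w l != 0) -> window n i != 0.
Proof. by move=> w0; apply/prodf_neq0 => l _. Qed.

Lemma weight_sup_infinite :
  ereal_sup [set a | exists i j : int,
    i <= j /\ a = (modulus (weight_prod w i j))%:E] = +oo%E <->
  forall C, exists i n, C <= modulus (window n i).
Proof.
split=> [sup C|large].
  have : (C%:E < +oo)%E by rewrite ltry.
  rewrite -sup => /ereal_sup_gt[_ [i [j [ij ->]]]]; rewrite lte_fin => /ltW Cij.
  exists i, (absz (j - i + 1)).
  rewrite -weight_prod_window gez0_abs; last by rewrite addr_ge0 ?subr_ge0.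
  by rewrite addrA (addrC i) subrK addrK.
(* The bound 2 rules out the empty window, of modulus 1, which corresponds to no pair [i <= j]. *)
apply: eq_infty => A; have [i [n]] := large (Num.max A 2).
rewrite ge_max => /andP[An n2]; case: n => [|n] in An n2 *.
  by move: n2; rewrite /window big_ord0 modulus1 lern1.
apply: (@le_trans _ _ (modulus (window n.+1 i))%:E); first by rewrite lee_fin.
apply: ereal_sup_ubound; exists i, (i + n%:Z); split; first by rewrite lerDl.
by rewrite -weight_prod_window -addn1 PoszD addrA addrK.
Qed.

Definition basis_orbit_norm (n : nat) (t : int) : R := modulus (window n (t - n%:Z)).

Lemma basis_orbit_normD a b t :
  basis_orbit_norm (a + b) t = basis_orbit_norm a (t - b%:Z) * basis_orbit_norm b t.
Proof.
rewrite /basis_orbit_norm windowD modulusM PoszD.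
by rewrite opprD addrA addrAC addrNK addrAC.
Qed.

(** The orbits of [e t] and [e 0] merge up to a nonzero factor: if [t > 0] the first reaches a
    multiple of [e 0], and if [t < 0] the second reaches a multiple of [e t]. *)
Lemma basis_orbit_norm_shift t : (forall l, w l != 0) ->
  exists c d d', 0 < c /\
    forall n, basis_orbit_norm (n + d) t = c * basis_orbit_norm (n + d') 0.
Proof.
move=> w0; have N0 n i : 0 < basis_orbit_norm n i.
  rewrite lt_neqAle modulus_ge0 andbT eq_sym; apply/eqP => /modulus_eq0/eqP.
  exact/negP/window_neq0.
case: (intP t) => [|q|q].
- by exists 1, 0%N, 0%N; split=> // n; rewrite mul1r.
- exists (basis_orbit_norm q.+1 q.+1), q.+1, 0%N; split=> // n.
  by rewrite basis_orbit_normD subrr addn0 mulrC.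
- exists (basis_orbit_norm q.+1 0)^-1, 0%N, q.+1; split; first by rewrite invr_gt0.
  by move=> n; rewrite addn0 basis_orbit_normD sub0r mulrC mulfK// gt_eqF.
Qed.

End window.

(** * Iterates of the shift and their norms *)

Lemma lp_mdist {R : realType} {k : scalar_kind} {p : R} {p1 : 1 <= p}
  (x y : lp_space k p1) : mdist x y = `|x - y|.
Proof. by rewrite distrC. Qed.

Lemma powR_modulus_le_norm {R : realType} {k : scalar_kind} {p : R} {p1 : 1 <= p}
  (x : lp_space k p1) i : modulus (x i) `^ p <= `|x| `^ p.
Proof.
by have := sum_le_lp_norm [fset i]%fset p1 (lp_summable x); rewrite big_seq_fset1.
Qed.

Lemma ge0_ler_powRE {R : realType} (p x y : R) : 0 < p -> 0 <= x -> 0 <= y ->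
  (x `^ p <= y `^ p) = (x <= y).
Proof.
move=> p0 x0 y0; apply/idP/idP => [|xy].
  by apply: contraLR; rewrite -!ltNge => yx; rewrite gt0_ltr_powR.
by rewrite ge0_ler_powR ?nnegrE// ltW.
Qed.

Section weighted_shift.
Context {R : realType} {k : scalar_kind} {p : R} (p1 : 1 <= p).
Context (w : int -> scalar_field R k) (wb : bounded_weights w).
Local Notation lp := (lp_space k p1).
Local Notation B := (@weighted_shift R k p p1 w wb).
Implicit Types x y : lp.

Let p0 : 0 < p. Proof. exact: lt_le_trans p1. Qed.

Lemma iter_shiftE n x i : iter n B x i = window w n i * x (i + n%:Z).
Proof.
elim: n i => [|n IHn] i; first by rewrite /window big_ord0 mul1r addr0.
rewrite iterS /= /weighted_shift_fun IHn mulrA -addrA -intS.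
by rewrite -(window1 w) -windowD.
Qed.

Lemma iter_shiftB n x y : iter n B x - iter n B y = iter n B (x - y).
Proof.
apply/val_inj/funext => i /=.
by rewrite iter_shiftE lp_funD lp_funN/= !fctE !iter_shiftE mulrBr.
Qed.

Lemma iter_shift_scale n (c : scalar_field R k) x :
  iter n B (c *: x) = c *: iter n B x.
Proof. by apply/val_inj/funext => i /=; rewrite !iter_shiftE/= mulrCA. Qed.

Lemma lp_normZ (c : scalar_field R k) x : `|c *: x| = modulus c * `|x|.
Proof.
have le_norm (a : scalar_field R k) y : `|a *: y| <= modulus a * `|y|.
  apply: (lp_norm_dominated p1 (modulus_ge0 a) (lp_summable y) _).2.
  by exists id => // i; rewrite modulusM.
apply/le_anti; rewrite le_norm/=; have [->|c0] := eqVneq c 0.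
  by rewrite modulus0 mul0r.
have mc0 : modulus c != 0 by apply: contraNneq c0 => /modulus_eq0 ->.
(* The reverse inequality is the same bound for [c^-1] applied to [c *: x]. *)
have := le_norm c^-1 (c *: x); rewrite scalerA mulVf// scale1r => xcx.
rewrite (le_trans (ler_wpM2l (modulus_ge0 c) xcx))// mulrA -modulusM mulfV//.
by rewrite modulus1 mul1r.
Qed.

Lemma iter_shift_norm_le n C x : 0 <= C ->
  (forall i, modulus (window w n i) <= C) -> `|iter n B x| <= C * `|x|.
Proof.
move=> C0 wC; apply: (lp_norm_dominated p1 C0 (lp_summable x) _).2.
exists (fun i => i + n%:Z) => [|i]; first exact: addIr.
by rewrite iter_shiftE modulusM ler_wpM2r ?modulus_ge0.
Qed.

Lemma weighted_shift_continuous : continuous B.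
Proof.
have [M wM] := wb; move=> x U /nbhs_ballP[e /= e0 eU].
have M0 : 0 <= M by exact: le_trans (modulus_ge0 _) (wM 0).
have M1 : 0 < M + 1 by rewrite ltr_wpDl.
apply/nbhs_ballP; exists (e / (M + 1)) => [|y]; first by rewrite /= divr_gt0.
rewrite ballEmdist/= lp_mdist ltr_pdivlMr// => xy.
apply: eU; rewrite ballEmdist/= lp_mdist; apply: le_lt_trans xy.
rewrite [X in `|X|](iter_shiftB 1 x y).
apply: (@le_trans _ _ (M * `|x - y|)).
  by apply: iter_shift_norm_le => // i; rewrite window1.
by rewrite mulrC ler_wpM2l// lerDl.
Qed.

(** Coordinate [t] of [x] is carried to place [t - n], and one coordinate never exceeds the norm. *)
Lemma iter_basis_norm_le n t x : basis_orbit_norm w n t * modulus (x t) <= `|iter n B x|.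
Proof.
rewrite -(@ge0_ler_powRE _ p)// ?mulr_ge0 ?modulus_ge0//.
apply: le_trans (powR_modulus_le_norm (iter n B x) (t - n%:Z)).
by rewrite iter_shiftE modulusM addrNK.
Qed.

Lemma exists_vector_of_weight (u : int -> R) (C : R) : (forall t, 0 <= u t) ->
  (forall F : seq int, uniq F -> \sum_(t <- F) u t <= C) ->
  exists x : lp, forall n,
    (forall t, basis_orbit_norm w n t `^ p * u t <= `|iter n B x| `^ p) /\
    (forall K, (forall F : seq int, uniq F ->
         \sum_(t <- F) basis_orbit_norm w n t `^ p * u t <= K) ->
       `|iter n B x| `^ p <= K).
Proof.
move=> u0 uC; have powK r : 0 <= r -> (r `^ p^-1) `^ p = r.
  by move=> r0; rewrite -powRrM mulVf ?gt_eqF// powRr1.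
pose f t := scalar_of_real k (u t `^ p^-1).
have fE t : modulus (f t) `^ p = u t.
  by rewrite modulus_of_real ger0_norm ?powR_ge0// powK.
have C0 : 0 <= C by have := uC [::] isT; rewrite big_nil.
have [||f_sum _] := @lp_norm_le R k p f (C `^ p^-1) p1.
- exact: powR_ge0.
- by move=> F; rewrite powK//; under eq_bigr do rewrite fE; exact/uC/fset_uniq.
exists (LpSpace p1 f_sum) => n; set x := LpSpace _ _.
have xE t : modulus (x t) `^ p = u t by exact: fE.
split=> [t|K uK].
  rewrite -xE -powRM ?modulus_ge0// ge0_ler_powRE ?mulr_ge0 ?modulus_ge0//.
  exact: iter_basis_norm_le.
have K0 : 0 <= K by have := uK [::] isT; rewrite big_nil.
rewrite -[leRHS]powK// ge0_ler_powRE ?powR_ge0//.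
apply: (@lp_norm_le R k p (iter n B x) _ p1 (powR_ge0 _ _) _).2 => F; rewrite powK//.
(* Coordinate [i] of the iterate comes from coordinate [i + n] of [x]. *)
have := uK [seq i + n%:Z | i <- F]; rewrite big_map map_inj_uniq ?fset_uniq//; last first.
  exact: addIr.
move=> /(_ isT); apply: le_trans; apply: ler_sum => i _.
rewrite iter_shiftE modulusM powRM ?modulus_ge0// xE.
by rewrite /basis_orbit_norm addrK.
Qed.

End weighted_shift.

(** * Reduction of chaos to a single orbit *)

Lemma li_yorke_chaotic_shiftP {R : realType} {k : scalar_kind} {p : R}
    (p1 : 1 <= p) (w : int -> scalar_field R k) (wb : bounded_weights w) :
  li_yorke_chaotic (@weighted_shift R k p p1 w wb) <->
  exists x : lp_space k p1,
    (forall e, 0 < e -> forall n, exists2 m, (n <= m)%N &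
      `|iter m (weighted_shift wb) x| < e) /\
    (exists2 e, 0 < e & forall n, exists2 m, (n <= m)%N &
      e <= `|iter m (weighted_shift wb) x|).
Proof.
split=> [[_ [S [S_unc S_ly]]]|[x [x_inf x_sup]]].
  have [y [z [Sy Sz yz]]] : exists y z, [/\ S y, S z & y <> z].
    apply: contrapT => nyz; apply: S_unc.
    have [->|/set0P[y Sy]] := eqVneq S set0; first exact: countable0.
    apply: (@sub_countable _ _ _ [set y]) => //.
    apply: subset_card_le => z Sz /=; apply: contrapT => zy.
    by apply: nyz; exists z, y.
  exists (y - z); have [] := S_ly y z Sy Sz yz.
  under eq_fun do rewrite lp_mdist iter_shiftB.
  by move=> /limn_einf_eq0P yz_inf /limn_esup_gt0P yz_sup; split=> //;
    exact: yz_inf.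
split; first exact: weighted_shift_continuous.
have distE (r s : R) n :
    mdist (iter n (weighted_shift wb) (scalar_of_real k r *: x))
          (iter n (weighted_shift wb) (scalar_of_real k s *: x)) =
    `|r - s| * `|iter n (weighted_shift wb) x|.
  rewrite lp_mdist !iter_shift_scale -scalerBl -scalar_of_realB lp_normZ.
  by rewrite modulus_of_real.
exists (range (fun r : R => scalar_of_real k r *: x)); split.
  (* Some iterate of [x] is nonzero, so distinct real multiples of [x] are distinct and the
     scrambled set is uncountable. *)
  have inj : injective (fun r : R => scalar_of_real k r *: x).
    move=> r s rs; have [e e0 /(_ 0%N)[m _ em]] := x_sup.
    have /esym/eqP := distE r s m; rewrite rs mdistxx mulf_eq0.
    rewrite (gt_eqF (lt_le_trans e0 em)) orbF normr_eq0 subr_eq0 => /eqP //.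
  move=> /countable_injP[f f_inj]; apply: (@uncountable_realType R).
  apply/countable_injP; exists (fun r => f (scalar_of_real k r *: x)).
  by move=> r s _ _ /f_inj rs; apply: inj; apply: rs; rewrite inE; eexists.
move=> _ _ [r _ <-] [s _ <-] rs.
have rs0 : 0 < `|r - s|.
  by rewrite normr_gt0 subr_eq0; apply: contra_notN rs => /eqP ->.
split; under eq_fun do rewrite distE.
  apply/limn_einf_eq0P => [n|e e0 n]; first by rewrite mulr_ge0.
  have [m nm xm] := x_inf (e / `|r - s|) (divr_gt0 e0 rs0) n.
  by exists m => //; rewrite mulrC -ltr_pdivlMr.
have [e e0 xe] := x_sup; apply/limn_esup_gt0P.
exists (`|r - s| * e) => [|n]; first exact: mulr_gt0.
by have [m nm em] := xe n; exists m => //; rewrite ler_wpM2l.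
Qed.

(** * Construction of the vector *)

Section semi_irregular_vector.
Context {R : realType} {k : scalar_kind} {p : R} (p1 : 1 <= p).
Context (w : int -> scalar_field R k) (wb : bounded_weights w).
Context (w0 : forall n, w n != 0).
Local Notation N := (basis_orbit_norm w).
Local Notation B := (@weighted_shift R k p p1 w wb).

Let p0 : 0 < p. Proof. exact: lt_le_trans p1. Qed.

(** The vector arises from the unit mass at 0. *)
Lemma basis_vector_orbit : exists x : lp_space k p1, forall n, `|iter n B x| = N n 0.
Proof.
pose u (t : int) : R := (t == 0)%:R.
have sum_le (Q : int -> R) (F : seq int) : (forall t, 0 <= Q t) -> uniq F ->
    \sum_(t <- F) Q t * u t <= Q 0.
  move=> Q0 uF; have [F0|F0] := boolP (0 \in F).
    rewrite (bigD1_seq 0)//= /u eqxx mulr1 big1 ?addr0// => t /negPf ->.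
    by rewrite mulr0.
  rewrite big_seq big1 // => t tF; rewrite /u.
  by case: eqP tF F0 => [->|_ _ _]; [move=> ->|rewrite mulr0].
have [||x xN] := exists_vector_of_weight p1 w wb u 1.
- by move=> t; rewrite ler0n.
- move=> F uF; have := sum_le (fun=> 1) F (fun=> ler01) uF.
  by under eq_bigr do rewrite mul1r.
have Np t n : 0 <= N n t `^ p by exact: powR_ge0.
exists x => n; have [/(_ 0) lo /(_ (N n 0 `^ p)) up] := xN n.
apply/le_anti/andP; split; rewrite -(@ge0_ler_powRE _ p)// ?modulus_ge0//.
  by apply: up => F uF; exact: (sum_le (fun t => N n t `^ p)).
by apply: le_trans lo; rewrite /u eqxx mulr1.
Qed.

Lemma basis_orbit_cvg0 :
  (forall e, 0 < e -> exists n, forall m, (n <= m)%N -> N m 0 < e) ->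
  forall t e, 0 < e -> exists n, forall m, (n <= m)%N -> N m t < e.
Proof.
move=> N0 t e e0; have [c [d [d' [c0 Nt]]]] := basis_orbit_norm_shift w t w0.
have [n Nn] := N0 (e / c) (divr_gt0 e0 c0).
exists (n + d)%N => m nm; rewrite -(subnK (leq_trans (leq_addl _ _) nm)) Nt.
rewrite mulrC -ltr_pdivlMr//; apply: Nn.
by rewrite (leq_trans _ (leq_addr _ _))// leq_subRL ?(leq_trans (leq_addl _ _) nm)// addnC.
Qed.

Lemma exists_irregular_vector :
  (forall e, 0 < e -> exists n, forall m, (n <= m)%N -> N m 0 < e) ->
  (forall C, exists i n, C <= modulus (window w n i)) ->
  exists x : lp_space k p1,
    (forall e, 0 < e -> forall n, exists2 m, (n <= m)%N & `|iter m B x| < e) /\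
    (exists2 e, 0 < e & forall n, exists2 m, (n <= m)%N & e <= `|iter m B x|).
Proof.
move=> N0 w_unbounded; have [M wM] := wb.
(* The maximum with 1 makes the powers of [D] nondecreasing and at least 1, as [gliding_hump]
   requires. *)
pose D := Num.max M 1; have D1 : 1 <= D by rewrite le_max lexx orbT.
have D0 : 0 <= D by exact: le_trans D1.
have wD n i : modulus (window w n i) <= D ^+ n.
  by apply: modulus_window_le => l; rewrite le_max wM.
have [|||||u [u0 uC u_small u_large]] := @gliding_hump R int
    (fun n t => N n t `^ p) (fun n => (D ^+ n) `^ p).
- by move=> n t; rewrite powR_ge0 ge0_ler_powRE ?modulus_ge0 ?exprn_ge0// wD.
- move=> n; have <- : 1 `^ p = 1 :> R by rewrite powR1.
  by rewrite ge0_ler_powRE ?exprn_ge0// exprn_ege1.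
- move=> m n mn; rewrite ge0_ler_powRE ?exprn_ge0//; exact: ler_weXn2l.
- move=> t e e0; have ep0 : 0 < e `^ p^-1 by rewrite powR_gt0.
  have [n Nn] := basis_orbit_cvg0 N0 t _ ep0; exists n => m nm.
  have -> : e = (e `^ p^-1) `^ p by rewrite -powRrM mulVf ?gt_eqF// powRr1// ltW.
  by rewrite gt0_ltr_powR ?nnegrE ?modulus_ge0 ?powR_ge0// Nn.
- move=> C; have [i [n Cn]] := w_unbounded (`|C| `^ p^-1).
  exists (i + n%:Z), n; apply: (le_trans (ler_norm C)).
  have -> : `|C| = (`|C| `^ p^-1) `^ p by rewrite -powRrM mulVf ?gt_eqF// powRr1.
  by rewrite ge0_ler_powRE ?powR_ge0 ?modulus_ge0// /basis_orbit_norm addrK.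
have [x xP] := exists_vector_of_weight p1 w wb u 1 u0 uC.
exists x; split=> [e e0 n|].
  have e20 : 0 < e / 2 by rewrite divr_gt0.
  have [m nm um] := u_small ((e / 2) `^ p) (powR_gt0 _ e20) n; exists m => //.
  apply: (@le_lt_trans _ _ (e / 2)); last by rewrite ltr_pdivrMr// mulr_natr mulr2n ltrDl.
  by rewrite -(@ge0_ler_powRE _ p)// ?(ltW e20)//; apply: (xP m).2.
apply: contrapT => /not_limsup_gt0/(_ 1 ltr01)[n xn].
pose C := D ^+ n * `|x| + 1.
have C0 : 0 <= C by rewrite addr_ge0// mulr_ge0// exprn_ge0.
have [t [m Cm]] := u_large (C `^ p).
have {Cm} : C <= `|iter m B x|.
  by rewrite -(@ge0_ler_powRE _ p)//; exact: le_trans ((xP m).1 t).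
apply/negP; rewrite -ltNge; have [nm|mn] := leqP n m.
  by apply: (lt_le_trans (xn m nm)); rewrite lerDr mulr_ge0// exprn_ge0.
apply: (@le_lt_trans _ _ (D ^+ m * `|x|)).
  by apply: iter_shift_norm_le; rewrite ?exprn_ge0.
rewrite (@le_lt_trans _ _ (D ^+ n * `|x|)) ?ltrDl// ler_wpM2r//.
by rewrite ler_weXn2l// ltnW.
Qed.

End semi_irregular_vector.

(** * The equivalence *)

Theorem corollary15 (R : realType) (k : scalar_kind) (p : R) (p1 : 1 <= p)
    (w : int -> scalar_field R k) (wb : bounded_weights w) (w0 : forall n, w n != 0) :
  li_yorke_chaotic (@weighted_shift R k p p1 w wb) <->
  limn_einf (fun n : nat => (modulus (weight_prod w (- n%:Z) (- 1)))%:E) = 0%E /\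
  ereal_sup [set a | exists i j : int,
    i <= j /\ a = (modulus (weight_prod w i j))%:E] = +oo%E.
Proof.
have N0E n : modulus (weight_prod w (- n%:Z) (- 1)) = basis_orbit_norm w n 0.
  by rewrite /basis_orbit_norm sub0r -weight_prod_window addNr sub0r.
under eq_fun do rewrite N0E.
rewrite li_yorke_chaotic_shiftP weight_sup_infinite limn_einf_eq0P; last first.
  by move=> n; exact: modulus_ge0.
split=> [[x [x_inf [e e0 x_sup]]]|[N_inf w_unbounded]]; last first.
  (* Either [e 0] itself serves, or its orbit tends to 0 and the gliding hump applies. *)
  have [N_sup|/not_limsup_gt0 N_cvg0] := pselect (exists2 e, 0 < e &
      forall n, exists2 m, (n <= m)%N & e <= basis_orbit_norm w m 0).
    have [x xN] := basis_vector_orbit p1 w wb; exists x.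
    by split=> [e e0 n|]; [have [m] := N_inf e e0 n|have [e e0 eN] := N_sup;
      exists e => // n; have [m] := eN n]; exists m => //; rewrite xN.
  exact: exists_irregular_vector.
split=> [d d0 n|C].
  have [t xt] : exists t, x t != 0.
    apply: contrapT => nx; have [m _] := x_sup 0%N; apply/negP; rewrite -ltNge.
    suff -> : iter m (weighted_shift wb) x = 0 by rewrite normr0.
    apply/val_inj/funext => i /=; rewrite iter_shiftE.
    have [->|xi] := eqVneq (x (i + m%:Z)) 0; first by rewrite mulr0.
    by case: nx; exists (i + m%:Z).
  have mxt : 0 < modulus (x t).
    rewrite lt_neqAle modulus_ge0 andbT eq_sym.
    by apply: contraNneq xt => /modulus_eq0 ->.
  have [c [a [a' [c0 Nt]]]] := basis_orbit_norm_shift w t w0.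
  (* Below [d * c * modulus (x t)], the bound by coordinate [t] leaves [d] after division by
     [modulus (x t)] and by the factor [c] relating [t] to 0. Starting at [n + a] keeps [m - a] at
     least [n]. *)
  have dcx0 := mulr_gt0 (mulr_gt0 d0 c0) mxt.
  have [m nm xm] := x_inf _ dcx0 (n + a)%N.
  have am := leq_trans (leq_addl n a) nm.
  exists (m - a + a')%N.
    by rewrite (leq_trans _ (leq_addr _ _))// leq_subRL// addnC.
  rewrite -(ltr_pM2r c0) mulrC -Nt subnK// -(ltr_pM2r mxt).
  exact: le_lt_trans (iter_basis_norm_le p1 w wb m t x) xm.
apply: contrapT => C_bound.
have wC n i : modulus (window w n i) <= C.
  by rewrite leNgt; apply/negP => /ltW Cw; apply: C_bound; exists i, n.
have C0 : 0 <= C by exact: le_trans (modulus_ge0 _) (wC 0%N 0).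
have C1 : 0 < C + 1 by rewrite ltr_wpDl.
(* Under the uniform bound [C], an orbit that falls below [e / (C + 1)] stays below [e] forever,
   against [x_sup]; [C + 1] is positive even if [C] is 0. *)
have [n _ xn] := x_inf (e / (C + 1)) (divr_gt0 e0 C1) 0%N.
have [m nm] := x_sup n; apply/negP; rewrite -ltNge -(subnK nm) iterD.
apply: (le_lt_trans (iter_shift_norm_le p1 w wb _ _ _ C0 (wC (m - n)%N))).
move: xn; rewrite ltr_pdivlMr// mulrC; apply: le_lt_trans.
by rewrite ler_wpM2r// lerDl.
Qed.
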